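(* Let $A$ be a normal good pseudo-hoop and let $\mu$ be a state-morphism operator on the bounded pseudo-hoop ${\rm Inv}(A)$ with $\mu(0)=0$. Define $\tilde\mu:A\to A$ by $\tilde\mu(x)=\mu(x^{-\sim})$ for all $x\in A$. Then $\tilde\mu$ is a state-morphism operator on $A$ with $\tilde\mu(0)=0$, and the restriction of $\tilde\mu$ to ${\rm Inv}(A)$ equals $\mu$.
   Context: A pseudo-hoop is an algebra $(A,\odot,\rightarrow,\rightsquigarrow,1)$ of type $(2,2,2,0)$ such that for all $x,y,z\in A$: $x\odot 1=1\odot x=x$; $x\rightarrow x=x\rightsquigarrow x=1$; $(x\odot y)\rightarrow z=x\rightarrow(y\rightarrow z)$; $(x\odot y)\rightsquigarrow z=y\rightsquigarrow(x\rightsquigarrow z)$; $(x\rightarrow y)\odot x=(y\rightarrow x)\odot y=x\odot(x\rightsquigarrow y)=y\odot(y\rightsquigarrow x)$. The order is $x\le y$ iff $x\rightarrow y=1$. It is bounded if it has a least element $0$; then $x^-=x\rightarrow 0$, $x^\sim=x\rightsquigarrow 0$, $x^{-\sim}=(x^-)^\sim$, $x^{\sim-}=(x^\sim)^-$. It is good if $x^{-\sim}=x^{\sim-}$ for all $x$, and normal if (bounded and) $(x\odot y)^{-\sim}=x^{-\sim}\odot y^{-\sim}$ and $(x\odot y)^{\sim-}=x^{\sim-}\odot y^{\sim-}$ for all $x,y$. ${\rm Inv}(A)=\{x\in A\mid x^{-\sim}=x^{\sim-}=x\}$; for a normal good pseudo-hoop it contains $0,1$ and is closed under $\odot,\rightarrow,\rightsquigarrow$,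 so it is a bounded pseudo-hoop with the restricted operations. A state-morphism operator on a pseudo-hoop $B$ is a map $\mu:B\to B$ with $\mu(x\odot y)=\mu(x)\odot\mu(y)$, $\mu(x\rightarrow y)=\mu(x)\rightarrow\mu(y)$, $\mu(x\rightsquigarrow y)=\mu(x)\rightsquigarrow\mu(y)$ for all $x,y$, and $\mu\circ\mu=\mu$. *)

(* Defs.v *)
From Stdlib Require Import ProofIrrelevance Setoid.

Set Implicit Arguments.
Unset Strict Implicit.
Unset Printing Implicit Defensive.

Declare Scope hoop_scope.
Delimit Scope hoop_scope with hoop.
Local Open Scope hoop_scope.

Reserved Notation "x --> y" (at level 55, right associativity).
Reserved Notation "x ~~> y" (at level 55, right associativity).

Record pseudoHoop : Type := PseudoHoop {
  carrier :> Type;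
  mul : carrier -> carrier -> carrier;
  imp : carrier -> carrier -> carrier;
  simp : carrier -> carrier -> carrier;
  one : carrier;
  mulx1 : forall x, mul x one = x;
  mul1x : forall x, mul one x = x;
  impxx : forall x, imp x x = one;
  simpxx : forall x, simp x x = one;
  impM : forall x y z, imp (mul x y) z = imp x (imp y z);
  simpM : forall x y z, simp (mul x y) z = simp y (simp x z);
  imp_meetC : forall x y, mul (imp x y) x = mul (imp y x) y;
  imp_simp_meet : forall x y, mul (imp y x) y = mul x (simp x y);
  simp_meetC : forall x y, mul x (simp x y) = mul y (simp y x)
}.

Arguments one {p}.

Notation "x * y" := (mul x y) : hoop_scope.
Notation "x --> y" := (imp x y) : hoop_scope.
Notation "x ~~> y" := (simp x y) : hoop_scope.
Notation "1" := (@one _) : hoop_scope.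

Definition le (A : pseudoHoop) (x y : A) : Prop := x --> y = 1.
Notation "x <= y" := (le x y) : hoop_scope.

Record boundedPseudoHoop : Type := BoundedPseudoHoop {
  hoop_of :> pseudoHoop;
  zero : hoop_of;
  le0x : forall x : hoop_of, zero <= x
}.

Arguments zero {b}.
Notation "0" := (@zero _) : hoop_scope.

Definition neg (A : boundedPseudoHoop) (x : A) : A := x --> 0.
Definition sneg (A : boundedPseudoHoop) (x : A) : A := x ~~> 0.

Notation "x ^-" := (neg x) (at level 2, format "x ^-") : hoop_scope.
Notation "x ^~" := (sneg x) (at level 2, format "x ^~") : hoop_scope.

Definition good (A : boundedPseudoHoop) : Prop :=
  forall x : A, x^-^~ = x^~^-.

Definition normal (A : boundedPseudoHoop) : Prop :=
  forall x y : A, (x * y)^-^~ = x^-^~ * y^-^~ /\ (x * y)^~^- = x^~^- * y^~^-.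

Definition is_inv (A : boundedPseudoHoop) (x : A) : Prop :=
  x^-^~ = x /\ x^~^- = x.

Definition state_morphism (B : pseudoHoop) (mu : B -> B) : Prop :=
  (forall x y, mu (x * y) = mu x * mu y) /\
  (forall x y, mu (x --> y) = mu x --> mu y) /\
  (forall x y, mu (x ~~> y) = mu x ~~> mu y) /\
  (forall x, mu (mu x) = mu x).

(* Exchanging the two implications and reversing the product is a duality. *)
Definition opp_hoop (A : pseudoHoop) : pseudoHoop.
Proof.
refine (@PseudoHoop A (fun x y => y * x) (fun x y => x ~~> y)
          (fun x y => x --> y) 1 _ _ _ _ _ _ _ _ _).
- exact (@mul1x A).
- exact (@mulx1 A).
- exact (@simpxx A).
- exact (@impxx A).
- intros x y z; apply simpM.
- intros x y z; apply impM.
- exact (@simp_meetC A).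
- intros x y; symmetry; apply imp_simp_meet.
- exact (@imp_meetC A).
Defined.

Lemma imp_antisym (A : pseudoHoop) (x y : A) :
  x --> y = 1 -> y --> x = 1 -> x = y.
Proof.
intros xy yx.
rewrite <- (mul1x x), <- xy, imp_meetC, yx; apply mul1x.
Qed.

Lemma imp_inj (A : pseudoHoop) (x y : A) :
  (forall z, x --> z = y --> z) -> x = y.
Proof.
intros E; apply imp_antisym.
- rewrite E; apply impxx.
- rewrite <- E; apply impxx.
Qed.

Lemma mulA (A : pseudoHoop) (x y z : A) : x * (y * z) = x * y * z.
Proof. apply imp_inj; intros w; rewrite !impM; reflexivity. Qed.

Lemma imp1x (A : pseudoHoop) (x : A) : 1 --> x = x.
Proof.
assert (E : 1 --> x = (x --> 1) * x).
{ rewrite <- imp_meetC; symmetry; apply mulx1. }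
assert (P1 : ((x --> 1) --> 1) * (x --> 1) = x --> 1).
{ rewrite imp_meetC, mulx1, <- impM, mul1x; reflexivity. }
assert (F : x = ((x --> 1) --> 1) * ((x --> 1) * x)).
{ assert (G : (1 --> x) --> x = (x --> 1) --> 1).
  { rewrite E, impM, impxx; reflexivity. }
  rewrite <- E, <- G, imp_meetC, <- impM, mulx1, impxx, mul1x; reflexivity. }
rewrite mulA, P1 in F.
rewrite E; symmetry; exact F.
Qed.

Lemma impx1 (A : pseudoHoop) (x : A) : x --> 1 = 1.
Proof.
assert (E : (x --> 1) * x = x).
{ rewrite imp_meetC, mulx1; apply imp1x. }
rewrite <- E at 1; rewrite impM; apply impxx.
Qed.

Lemma simpx1 (A : pseudoHoop) (x : A) : x ~~> 1 = 1.
Proof. exact (@impx1 (opp_hoop A) x). Qed.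

Lemma imp_simp_le (A : pseudoHoop) (x y : A) : x --> y = 1 -> x ~~> y = 1.
Proof.
intros xy.
assert (E : x = y * (y ~~> x)).
{ rewrite <- imp_simp_meet, xy, mul1x; reflexivity. }
rewrite E at 1; rewrite simpM, simpxx; apply simpx1.
Qed.

Lemma simp_imp_le (A : pseudoHoop) (x y : A) : x ~~> y = 1 -> x --> y = 1.
Proof. exact (@imp_simp_le (opp_hoop A) x y). Qed.

Definition opp_bounded (A : boundedPseudoHoop) : boundedPseudoHoop :=
  @BoundedPseudoHoop (opp_hoop A) (@zero A)
    (fun x => imp_simp_le (le0x x)).

Lemma mul0x (A : boundedPseudoHoop) (x : A) : 0 * x = 0.
Proof.
apply imp_antisym; [|apply le0x].
rewrite impM; apply le0x.
Qed.

Lemma neg_dneg (A : boundedPseudoHoop) (x : A) : x^-^~^- = x^-.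
Proof.
apply imp_antisym.
- assert (E : x = x^-^~ * (x^-^~ ~~> x)).
  { rewrite <- imp_simp_meet.
    replace (x --> x^-^~) with (@one A); [symmetry; apply mul1x|symmetry].
    apply simp_imp_le; unfold sneg; rewrite <- simpM.
    apply imp_simp_le; unfold neg at 1; rewrite impM; apply impxx. }
  unfold neg at 3; rewrite <- impM.
  rewrite E at 2; rewrite mulA.
  replace (x^-^~^- * x^-^~) with (@zero A); [rewrite mul0x; apply impxx|].
  unfold neg at 1; rewrite imp_meetC, (le0x (x^-^~)), mul1x; reflexivity.
- unfold neg at 2; rewrite <- impM.
  apply simp_imp_le; rewrite simpM; apply simpxx.
Qed.

Lemma sneg_dneg (A : boundedPseudoHoop) (x : A) : x^~^-^~ = x^~.
Proof. exact (@neg_dneg (opp_bounded A) x). Qed.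

Section Inv.
Variables (A : boundedPseudoHoop) (gA : good A) (nA : normal A).

Lemma is_inv_dneg (x : A) : is_inv x^-^~.
Proof.
unfold is_inv; rewrite neg_dneg; split; [reflexivity|].
rewrite (gA x); f_equal; apply sneg_dneg.
Qed.

Lemma is_inv_neg (x : A) : is_inv x^-.
Proof. unfold is_inv; rewrite (gA x^-), neg_dneg; split; reflexivity. Qed.

Lemma is_inv_sneg (x : A) : is_inv x^~.
Proof. unfold is_inv; rewrite <- (gA x^~), sneg_dneg; split; reflexivity. Qed.

Lemma is_inv1 : is_inv (@one A).
Proof.
unfold is_inv, neg, sneg; rewrite imp1x.
replace (1 ~~> 0) with (@zero A); [|symmetry; apply (@imp1x (opp_hoop A))].
rewrite simpxx, impxx; split; reflexivity.
Qed.

Lemma is_inv0 : is_inv (@zero A).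
Proof. rewrite <- (imp1x (@zero A)); apply is_inv_neg. Qed.

Lemma is_invM (x y : A) : is_inv x -> is_inv y -> is_inv (x * y).
Proof.
intros [x1 x2] [y1 y2]; destruct (nA x y) as [n1 n2]; split.
- rewrite n1, x1, y1; reflexivity.
- rewrite n2, x2, y2; reflexivity.
Qed.

Lemma is_inv_imp (x y : A) : is_inv x -> is_inv y -> is_inv (x --> y).
Proof.
intros _ [_ y2]; rewrite <- y2; unfold neg; rewrite <- impM; apply is_inv_neg.
Qed.

Lemma is_inv_simp (x y : A) : is_inv x -> is_inv y -> is_inv (x ~~> y).
Proof.
intros _ [y1 _]; rewrite <- y1; unfold sneg; rewrite <- simpM; apply is_inv_sneg.
Qed.

Definition inv_carrier : Type := {x : A | is_inv x}.

Lemma inv_val_inj (x y : inv_carrier) : proj1_sig x = proj1_sig y -> x = y.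
Proof. apply eq_sig_hprop; intros z p q; apply proof_irrelevance. Qed.

Definition inv_mul (x y : inv_carrier) : inv_carrier :=
  exist _ (proj1_sig x * proj1_sig y) (is_invM (proj2_sig x) (proj2_sig y)).

Definition inv_imp (x y : inv_carrier) : inv_carrier :=
  exist _ (proj1_sig x --> proj1_sig y) (is_inv_imp (proj2_sig x) (proj2_sig y)).

Definition inv_simp (x y : inv_carrier) : inv_carrier :=
  exist _ (proj1_sig x ~~> proj1_sig y) (is_inv_simp (proj2_sig x) (proj2_sig y)).

Definition inv_hoop : pseudoHoop.
Proof.
refine (@PseudoHoop inv_carrier inv_mul inv_imp inv_simp (exist _ 1 is_inv1)
          _ _ _ _ _ _ _ _ _); intros; apply inv_val_inj; cbn.
- apply mulx1.
- apply mul1x.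
- apply impxx.
- apply simpxx.
- apply impM.
- apply simpM.
- apply imp_meetC.
- apply imp_simp_meet.
- apply simp_meetC.
Defined.

Definition Inv : boundedPseudoHoop.
Proof.
refine (@BoundedPseudoHoop inv_hoop (exist _ 0 is_inv0) _).
intros x; apply inv_val_inj; apply le0x.
Defined.

Definition inv_val (x : Inv) : A := proj1_sig x.

Definition inv_dneg (x : A) : Inv := exist _ x^-^~ (is_inv_dneg x).

Definition mu_tilde (mu : Inv -> Inv) (x : A) : A := inv_val (mu (inv_dneg x)).

End Inv.

Arguments Inv {A} gA nA.

(* Main.v *)
(** The double negation [x^-^~] commutes with both implications, so it is a
    homomorphism onto Inv(A), and composing it with [mu] gives the result.  The
    point is that [d = x^-^~ --> x] is dense, [d^- = 0].  Indeed [d * x^-^~ = x]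
    yields [x^- = d --> x^-], while [x^- * x^-^~ = 0] yields [x^- <= d]; hence
    [x^- * d = x^-], and [d^- <= x^-] gives [d^- = (x^- --> d^-) * x^- =
    (x^- * d)^- * x^- = x^-^- * x^- = 0].  By normality, the inequality
    [d * (x --> y^-^~) <= x --> y], with [d = y^-^~ --> y], turns into
    [x --> y^-^~ <= (x --> y)^-^~]. *)

Require Import Defs.
Local Open Scope hoop_scope.

Section PseudoHoop.
Set Implicit Arguments.
Context {A : pseudoHoop}.
Implicit Types x y z : A.

Lemma le_simp x y : x <= y <-> x ~~> y = 1.
Proof. split; [apply imp_simp_le | apply simp_imp_le]. Qed.

Lemma le_refl x : x <= x.
Proof. apply impxx. Qed.

Lemma le_meet x y : x <= y -> (y --> x) * y = x.
Proof. intros xy; rewrite imp_meetC, xy; apply mul1x. Qed.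

Lemma le_trans x y z : x <= y -> y <= z -> x <= z.
Proof.
intros xy yz; unfold le.
(* Divisibility writes [x] as [(y --> x) * y], so [x --> z] becomes [(y --> x) --> (y --> z)], whose
   inner implication is 1. *)
rewrite <- (le_meet xy), impM, yz; apply impx1.
Qed.

Lemma le_imp x y z : x * y <= z <-> x <= y --> z.
Proof. unfold le; rewrite impM; reflexivity. Qed.

Lemma le_simp_imp x y z : x * y <= z <-> y <= x ~~> z.
Proof. rewrite !le_simp, simpM; reflexivity. Qed.

Lemma le_mull x y z : x <= y -> z * x <= z * y.
Proof.
intros xy; apply le_simp_imp, (le_trans xy), le_simp_imp, le_refl.
Qed.

Lemma le_mulr x y z : x <= y -> x * z <= y * z.
Proof. intros xy; apply le_imp, (le_trans xy), le_imp, le_refl. Qed.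

Lemma imp_mp x y : (x --> y) * x <= y.
Proof. apply le_imp, le_refl. Qed.

Lemma simp_mp x y : x * (x ~~> y) <= y.
Proof. apply le_simp_imp, le_refl. Qed.

Lemma le_imp2l x y z : x <= y -> z --> x <= z --> y.
Proof. intros xy; apply le_imp, (le_trans (imp_mp z x) xy). Qed.

Lemma le_imp2r x y z : x <= y -> y --> z <= x --> z.
Proof. intros xy; apply le_imp, (le_trans (le_mull (y --> z) xy)), imp_mp. Qed.

Lemma le_simp2r x y z : x <= y -> y ~~> z <= x ~~> z.
Proof.
intros xy; apply le_simp_imp, (le_trans (le_mulr (y ~~> z) xy)), simp_mp.
Qed.

Lemma le_ext x y : (forall z, z <= x <-> z <= y) -> x = y.
Proof. intros E; apply imp_antisym; apply E, le_refl. Qed.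

(** The two residuals act on opposite sides: by associativity, [w] lies below either term exactly
    when [y * w * x <= z]. *)
Lemma imp_simpC x y z : x --> (y ~~> z) = y ~~> (x --> z).
Proof.
apply le_ext; intros w.
rewrite <- le_imp, <- !le_simp_imp, <- le_imp, mulA; reflexivity.
Qed.

End PseudoHoop.

Section Bounded.
Set Implicit Arguments.
Context {A : boundedPseudoHoop}.
Implicit Types x y : A.

Lemma lex0 x : x <= 0 -> x = 0.
Proof. intros x0; apply (imp_antisym x0), le0x. Qed.

Lemma le_dneg x : x <= x^-^~.
Proof. apply le_simp_imp, imp_mp. Qed.

Lemma dneg_mono x y : x <= y -> x^-^~ <= y^-^~.
Proof. intros xy; apply le_simp2r, le_imp2r, xy. Qed.

Lemma dneg0 : (@zero A)^-^~ = 0.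
Proof.
unfold neg, sneg; rewrite impxx; exact (@imp1x (opp_hoop A) 0).
Qed.

(** Contraposition turns the two sides into [y^- ~~> x^-] and [y^- ~~> x^-^~^-], which agree because
    triple negation collapses. *)
Lemma imp_dneg x y : x --> y^-^~ = x^-^~ --> y^-^~.
Proof.
transitivity (y^- ~~> x^-); [apply imp_simpC|].
rewrite <- (neg_dneg x) at 1; symmetry; apply imp_simpC.
Qed.

Lemma neg_dneg_imp x : (x^-^~ --> x)^- = 0.
Proof.
set (d := x^-^~ --> x).
assert (dx : x^- = d --> x^-).
{ rewrite <- (le_meet (le_dneg x)) at 1; fold d.
  unfold neg at 1; rewrite impM; fold (neg (x^-^~)).
  rewrite neg_dneg; reflexivity. }
assert (xd : x^- <= d).
{ apply le_imp, (le_trans (simp_mp x^- 0)), le0x. }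
assert (xdx : x^- * d = x^-).
{ rewrite dx at 1; rewrite imp_meetC, xd; apply mul1x. }
assert (ux : d^- <= x^-).
{ rewrite dx; apply le_imp2l, le0x. }
apply lex0; rewrite <- (le_meet ux).
unfold neg at 2; rewrite <- impM, xdx; apply imp_mp.
Qed.

Lemma dneg_dense x : (x^-^~ --> x)^-^~ = 1.
Proof. rewrite neg_dneg_imp; apply simpxx. Qed.

Hypotheses (gA : good A) (nA : normal A).

Lemma dneg_imp x y : (x --> y)^-^~ = x^-^~ --> y^-^~.
Proof.
(* By [imp_dneg] this is an implication between elements of Inv(A), hence fixed by double
   negation. *)
assert (E : (x --> y^-^~)^-^~ = x --> y^-^~).
{ rewrite imp_dneg; apply (is_inv_imp gA); apply (is_inv_dneg gA). }
rewrite <- imp_dneg; apply imp_antisym.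
- rewrite <- E; apply dneg_mono, le_imp2l, le_dneg.
- assert (D : (y^-^~ --> y) * (x --> y^-^~) <= x --> y).
  { apply (le_imp _ x y); rewrite <- mulA.
    apply (le_trans (le_mull _ (imp_mp x y^-^~))), imp_mp. }
  apply dneg_mono in D; revert D.
  rewrite (proj1 (nA _ _)), dneg_dense, mul1x, E; exact (fun D => D).
Qed.

End Bounded.

(** Dual of [dneg_imp]: in the opposite hoop the double negation is [x^~^-], which goodness
    identifies with [x^-^~]. *)
Lemma dneg_simp (A : boundedPseudoHoop) (gA : good A) (nA : normal A) (x y : A) :
  (x ~~> y)^-^~ = x^-^~ ~~> y^-^~.
Proof.
assert (gO : good (opp_bounded A)) by (intros z; symmetry; apply gA).
assert (nO : normal (opp_bounded A)).
{ intros z w; split; [exact (proj2 (nA w z)) | exact (proj1 (nA w z))]. }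
rewrite !gA; exact (dneg_imp gO nO x y).
Qed.

Theorem theorem6p10 (A : boundedPseudoHoop) (gA : good A) (nA : normal A)
    (mu : Inv gA nA -> Inv gA nA)
    (mu_sm : state_morphism mu) (mu0 : mu 0 = 0) :
  state_morphism (mu_tilde mu) /\
  mu_tilde mu 0 = 0 /\
  (forall x : Inv gA nA, mu_tilde mu (inv_val x) = inv_val (mu x)).
Proof.
destruct mu_sm as (muM & muI & muS & muK).
(* Double negation retracts A onto Inv(A); both idempotence and the restriction claim follow from
   this. *)
assert (dnegK : forall x : Inv gA nA, inv_dneg gA nA (inv_val x) = x).
{ intros x; apply inv_val_inj; exact (proj1 (proj2_sig x)). }
unfold mu_tilde; repeat split.
- intros x y.
  replace (inv_dneg gA nA (x * y)) with (inv_dneg gA nA x * inv_dneg gA nA y).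
  + rewrite muM; reflexivity.
  + apply inv_val_inj; symmetry; apply nA.
- intros x y.
  replace (inv_dneg gA nA (x --> y)) with (inv_dneg gA nA x --> inv_dneg gA nA y).
  + rewrite muI; reflexivity.
  + apply inv_val_inj; symmetry; exact (dneg_imp gA nA x y).
- intros x y.
  replace (inv_dneg gA nA (x ~~> y)) with (inv_dneg gA nA x ~~> inv_dneg gA nA y).
  + rewrite muS; reflexivity.
  + apply inv_val_inj; symmetry; exact (dneg_simp gA nA x y).
- intros x; rewrite dnegK, muK; reflexivity.
- replace (inv_dneg gA nA 0) with (@zero (Inv gA nA)).
  + rewrite mu0; reflexivity.
  + apply inv_val_inj; symmetry; apply dneg0.
- intros x; rewrite dnegK; reflexivity.
Qed.
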